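(* For every $n\in\mathbb{N}$, the cardinality of the set $\mathcal{E}_n$ of excessive multisegments of length $n$ is the $n$-th Motzkin number.
   Context: $\mathbb{N}$ contains $0$, and $[i,j]$ denotes the interval of integers from $i$ to $j$. The $n$-th Motzkin number is the number of maps $\gamma:[0,n]\to\mathbb{N}$ with $\gamma(0)=\gamma(n)=0$ and $|\gamma(k)-\gamma(k+1)|\le1$ for all $k\in[0,n-1]$ (Motzkin paths of length $n$). A multisegment over $[1,n]$ is a finite multiset of segments $[i,j]$, $1\le i\le j\le n$. For $n\ge1$, $\mathcal{R}_n$ is the set of multisegments over $[1,n]$ such that every $k\in[1,n]$ lies in exactly $n+1$ segments (with multiplicity). For $1\le k\le n-1$, a segment $[i,j]$ contains the column $k$ if $i\le k<j$; $M\in\mathcal{R}_n$ has $c$ cuts at column $k$ if exactly $n+1-c$ of its segments contain the column $k$. $\mathcal{M}_n\subseteq\mathcal{R}_n$ is the set of multisegments with at most one cut at every column; $\mathcal{M}_0$ is the singleton consisting of the empty multisegment. A pair of segments $(A,B)$ is linked if $A$ begins strictly before $B$, $B$ ends strictly after $A$, and $A\cup B$ is a segment (interval of integers). It is quasi-linked if it is linked or $a+1=b-1$, where $a$ is the end of $A$ and $b$ the beginning of $B$. A triple $(A,B,C)$ is linked if $(A,B)$ and $(B,C)$ are linked and $(A,C)$ is quasi-linked. For $n>0$, $M\in\mathcal{M}_n$ is excessive if no triple of its segments is linked; $\mathcal{E}_n$ is the set of excessive multisegments in $\mathcal{M}_n$, and $\mathcal{E}_0=\mathcal{M}_0$. 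*)

(* Defs.v *)
From HB Require Import structures.
From mathcomp Require Import all_boot all_order ssralg ssrnum ssrint.
From mathcomp Require Import finmap multiset.
From mathcomp Require Import boolp classical_sets functions cardinality.

Set Implicit Arguments.
Unset Strict Implicit.
Unset Printing Implicit Defensive.

Local Open Scope nat_scope.
Local Open Scope mset_scope.
Local Open Scope classical_set_scope.

Definition motzkin_paths (n : nat) : set {ffun 'I_n.+1 -> nat} :=
  [set g : {ffun 'I_n.+1 -> nat} | [/\ g ord0 = 0, g ord_max = 0 &
    forall i j : 'I_n.+1, j = i.+1 :> nat ->
      `|(g i : int) - (g j : int)|%N <= 1]].

Arguments motzkin_paths : clear implicits.

(* [fset_set] returns the empty set on infinite sets; this default is never
   reached here. *)
Lemma finite_motzkin_paths n : finite_set (motzkin_paths n).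
Proof.
pose emb (h : {ffun 'I_n.+1 -> 'I_n.+1}) : {ffun 'I_n.+1 -> nat} :=
  [ffun i => (h i : nat)].
apply: (@sub_finite_set _ _ (emb @` setT)); last exact/finite_image/finite_finset.
move=> g [g0 _ gS].
have gle i (lti : i < n.+1) : g (Ordinal lti) <= i.
  elim: i lti => [|i IHi] lti.
    by rewrite (_ : Ordinal lti = ord0) ?g0 //; apply: val_inj.
  have := gS (Ordinal (ltnW lti)) (Ordinal lti) erefl.
  have := IHi (ltnW lti).
  move: (g (Ordinal lti)) (g (Ordinal (ltnW lti))) => b a leai.
  case: (leqP b a) => [leba _|ltab]; first by rewrite (leq_trans leba) ?leqW.
  rewrite distnEr ?(ltnW ltab) // leq_subLR addn1 => leba.
  exact: leq_trans leba _.
exists [ffun i => inord (g i)] => //.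
apply/ffunP => -[i lti]; rewrite !ffunE inordK //.
by rewrite ltnS (leq_trans (gle i lti)).
Qed.

Definition motzkin (n : nat) : nat := #|` fset_set (motzkin_paths n)|%fset.

Definition segment (n : nat) : Type :=
  {s : nat * nat | (1 <= s.1) && (s.1 <= s.2 <= n)}.
HB.instance Definition _ n := Choice.on (segment n).

Section Multisegments.
Variable n : nat.
Implicit Types (A B C : segment n) (M : {mset segment n}) (k c : nat).

Definition sbegin A : nat := (val A).1.
Definition send A : nat := (val A).2.

Definition covers k A : bool := sbegin A <= k <= send A.
Definition contains_column k A : bool := sbegin A <= k < send A.

(* [count] runs over [enum_mset M], so it takes multiplicities into account. *)
Definition regular : set {mset segment n} :=
  [set M : {mset segment n} | forall k, 1 <= k <= n -> count (covers k) M = n.+1].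

(* Stated additively to avoid truncated subtraction. *)
Definition has_cuts M k c : Prop := count (contains_column k) M + c = n.+1.

(* For n = 0 there are no segments, hence this is the singleton of the empty
   multisegment, cf. [few_cuts0] below. *)
Definition few_cuts : set {mset segment n} :=
  [set M : {mset segment n} | regular M /\
    forall k, 1 <= k < n -> exists2 c, c <= 1 & has_cuts M k c].

Definition linked A B : Prop :=
  [/\ sbegin A < sbegin B, send A < send B &
      exists C, forall k, covers k C = covers k A || covers k B].

(* Beginnings of segments are positive, so the subtraction is exact. *)
Definition quasi_linked A B : Prop :=
  linked A B \/ send A + 1 = sbegin B - 1.

Definition linked_triple A B C : Prop :=
  [/\ linked A B, linked B C & quasi_linked A C].

Definition excessive : set {mset segment n} :=
  [set M : {mset segment n} | few_cuts M /\
    ~ exists A B C, [/\ A \in M, B \in M, C \in M & linked_triple A B C]].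

End Multisegments.

Arguments regular : clear implicits.
Arguments few_cuts : clear implicits.
Arguments excessive : clear implicits.

Lemma segment0F (A : segment 0) : False.
Proof.
by case: A => -[i j] /= /and3P[i1 ij j0]; have := leq_trans (leq_trans i1 ij) j0.
Qed.

Lemma few_cuts0 : few_cuts 0 = [set mset0].
Proof.
apply/seteqP; split=> M /= => [_|_].
  by apply/msetP => A; case: (segment0F A).
by split=> k; [case: k | rewrite ltn0 andbF].
Qed.

Lemma excessive0 : excessive 0 = few_cuts 0.
Proof.
by apply/seteqP; split=> M => [[]|] // ?; split=> // -[A]; case: (segment0F A).
Qed.

(* Main.v *)
Require Import Defs.
From mathcomp Require Import all_boot finmap multiset.
From mathcomp Require Import classical_sets cardinality.
From mathcomp Require Import ssralg poly ssrint ring zify.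

(** Write a segment [x+1, y] as an arc (x, y), with 0 <= x < y <= n.  Then
    [(A, B, C)] is a linked triple exactly when x_A < x_B < x_C <= y_A + 1 and
    y_A < y_B < y_C ([linked_tripleP]), and a multisegment has at most one cut
    at every column exactly when n+1 arcs start at 0 and, at every inner
    column, as many arcs start as end, namely at most one ([few_cutsP]).  Such
    a multisegment is therefore the same thing as a word whose k-th letter says
    whether there is a cut at column k and, if so, where the arc that ends
    there started ([codes]).

    Read this word from left to right.  When an arc (x, y) ends, absence of
    linked triples forces the arcs with starts x+1, ..., y+1 to end in nested
    order: none of these starts may be closed as long as a later one of them is
    live, that is, not closed yet.  So all that
    matters is the increasing list of the live starts, where p is marked if it
    has to wait for the next live start (for the last live start, the next one
    is the one that a cut at the current column would create).  The rules for
    the possible letters and the resulting marked lists are given by [moves],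
    and [mem_ext] states that they generate exactly the admissible words.

    Finally the words are counted.  Let [a] = 1 + X + ... + X^(a-1).  To a list
    whose marks are true^a0 false true^a1 false ... true^am attach the weight
    [a0+2][a1+2]...[am+2].  The weights W' of the successors of a list of
    weight W satisfy X * sum W' + 1 = (1 + X + X^2) * W ([weight_balance]), so
    that sum W' = T W, where T p = ((1 + X + X^2) * p - p(0)) / X.  But T also
    describes Motzkin paths: if X^j stands for a path at height j, then T X^j
    is the sum of the heights that can come next.  Hence the number of words
    with l further letters is the constant term of T^l W.  The empty list has
    weight 1 + X = T 1, where 1 = X^0 stands for the height 0 at which Motzkin
    paths begin, and the extra factor T makes up for the n-1 inner columns
    against the n steps of a path. *)

Set Implicit Arguments.
Unset Strict Implicit.
Unset Printing Implicit Defensive.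

(** * Motzkin paths as iterates of a linear operator *)

Section MotzkinOperator.
Import GRing.Theory.
Local Open Scope ring_scope.
Implicit Types p q : {poly int}.

(** The generating polynomial of the heights one step further: each height j
    contributes j-1, j and j+1, and [drop_poly 1] divides by the indeterminate
    while discarding the step from 0 to -1. *)
Definition mstep p : {poly int} := drop_poly 1 ((1 + 'X + 'X^2) * p).

(** The number of paths of length [l] that end at height 0 and start at the
    heights listed, with multiplicities, by [p]. *)
Definition mcount l p : int := (iter l mstep p)`_0.

Lemma mstepD p q : mstep (p + q) = mstep p + mstep q.
Proof. by rewrite /mstep mulrDr drop_polyD. Qed.

Lemma mstep0 : mstep 0 = 0.
Proof. by rewrite /mstep mulr0 drop_poly0r. Qed.

Lemma mcountS l p : mcount l.+1 p = mcount l (mstep p).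
Proof. by rewrite /mcount iterSr. Qed.

Lemma mcountD l p q : mcount l (p + q) = mcount l p + mcount l q.
Proof. by elim: l p q => [|l IH] p q; rewrite ?mcountS ?mstepD ?IH // /mcount coefD. Qed.

Lemma mcount0 l : mcount l 0 = 0.
Proof. by elim: l => [|l IH]; rewrite ?mcountS ?mstep0 // /mcount coef0. Qed.

Lemma mcount_sum l (I : Type) (r : seq I) (F : I -> {poly int}) :
  mcount l (\sum_(i <- r) F i) = \sum_(i <- r) mcount l (F i).
Proof. by apply: (big_morph (mcount l)); [apply: mcountD | apply: mcount0]. Qed.

Lemma mstep_eq p q : 'X * q + 1 = (1 + 'X + 'X^2) * p -> mstep p = q.
Proof.
rewrite /mstep => <-; rewrite addrC [_ * q]mulrC -['X]expr1.
by rewrite drop_polyDMXn // size_poly1.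
Qed.

Lemma mstep1 : mstep 1 = 1 + 'X.
Proof. by apply: mstep_eq; ring. Qed.

Lemma mstepX j : mstep 'X^(j.+1) = 'X^(j.+2) + 'X^(j.+1) + 'X^j.
Proof.
rewrite /mstep -[RHS](drop_polyMXn_id 1); congr drop_poly.
by rewrite expr1 !exprS; ring.
Qed.

End MotzkinOperator.

Section CardSeq.
Local Open Scope classical_set_scope.

(** Both sides of the theorem are counted by means of duplicate-free lists. *)
Lemma card_eq_image_seq (T U : choiceType) (f : T -> U) (s : seq T) (A : set U) :
  uniq s -> {in s &, injective f} ->
  (forall u, A u <-> exists2 t, t \in s & u = f t) ->
  (A #= `I_(size s))%card.
Proof.
move=> us fI AE; have us' : uniq (map f s) by rewrite map_inj_in_uniq.
have -> : A = [set` [fset x in map f s]%fset].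
  apply/seteqP; split=> u /=; rewrite !inE /=.
    by move=> /AE[t ts ->]; apply: map_f.
  by move=> /mapP[t ts ->]; apply/AE; exists t.
by apply/card_eq_fsetP; rewrite card_fseq undup_id ?size_map.
Qed.

End CardSeq.

Section MotzkinPaths.
Implicit Types (p : seq nat) (j l : nat).

Fixpoint motzkin_seqs l j : seq (seq nat) :=
  if l is l'.+1 then
    [seq j :: p | p <- motzkin_seqs l' j.+1 ++ motzkin_seqs l' j ++
                       (if j is j'.+1 then motzkin_seqs l' j' else [::])]
  else if j == 0 then [:: [:: 0]] else [::].

Lemma size_motzkin_seqs l j : Posz (size (motzkin_seqs l j)) = mcount l ('X^j)%R.
Proof.
elim: l j => [|l IHl] j; first by rewrite /mcount coefXn /=; case: j.
rewrite mcountS /= size_map !size_cat !PoszD !IHl.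
case: j => [|j]; rewrite ?IHl.
  by rewrite GRing.expr0 mstep1 mcountD GRing.addr0 GRing.expr1 GRing.addrC.
by rewrite mstepX !mcountD GRing.addrA.
Qed.

Definition unit_step x y : bool := (x <= y.+1) && (y <= x.+1).

Lemma mem_map_cons (T : eqType) (x y : T) (s : seq T) (r : seq (seq T)) :
  (y :: s \in [seq x :: t | t <- r]) = (y == x) && (s \in r).
Proof.
apply/mapP/andP => [[t tr [-> ->]]|[/eqP-> sr]]; first by rewrite eqxx.
by exists s.
Qed.

Lemma mem_motzkin_seqs l j p : (p \in motzkin_seqs l j) =
  [&& size p == l.+1, head 0 p == j, last 0 p == 0 & sorted unit_step p].
Proof.
elim: l j p => [|l IHl] j [|x p].
- by case: j.
- rewrite /= eqSS size_eq0; case: p => [|y p]; last first.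
    by case: j => [|j] /=; rewrite ?inE ?eqseq_cons ?andbF.
  by case: j => [|j]; case: x => [|x]; rewrite ?inE /= ?andbF.
- by apply/mapP => -[].
rewrite mem_map_cons mem_cat mem_cat !IHl.
case: (eqVneq x j) => [->|]; last by rewrite /= andbF.
case: p => [|y p]; first by case: j => [|j]; rewrite ?IHl.
have -> : (y :: p \in (if j is j'.+1 then motzkin_seqs l j' else [::])) =
    [&& size (y :: p) == l.+1, y.+1 == j, last 0 (y :: p) == 0 &
        sorted unit_step (y :: p)].
  by case: j => [|j]; rewrite ?IHl //= andbF.
rewrite /= !eqSS /unit_step; case: (_ == l) => //=.
case: (_ == 0) => /=; last by rewrite !andbF.
by case: (path _ _ _); rewrite ?andbF // !andbT; lia.
Qed.

Lemma uniq_motzkin_seqs l j : uniq (motzkin_seqs l j).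
Proof.
elim: l j => [|l IHl] j /=; first by case: (j == 0).
rewrite map_inj_uniq; last by move=> s t [].
have disj i k : i != k -> has [in motzkin_seqs l i] (motzkin_seqs l k) = false.
  move=> neq_ik; apply/hasP => -[p]; rewrite /= !mem_motzkin_seqs.
  by case/and4P=> _ /eqP-> _ _ /and4P[_ /eqP eik _ _]; rewrite eik eqxx in neq_ik.
rewrite !cat_uniq !IHl has_cat disj ?gtn_eqF //.
case: j => [|j] //=; rewrite ?IHl !disj ?gtn_eqF //; lia.
Qed.

Lemma distn_le1 (x y : nat) : (`|(x : int) - (y : int)|%N <= 1) = unit_step x y.
Proof. by rewrite /unit_step; lia. Qed.

Lemma motzkinE n : motzkin n = size (motzkin_seqs n 0).
Proof.
apply/card_fset_set.
apply: (card_eq_image_seq (f := fun p => [ffun i : 'I_n.+1 => nth 0 p i])).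
- exact: uniq_motzkin_seqs.
- move=> p q; rewrite !mem_motzkin_seqs => /andP[/eqP sp _] /andP[/eqP sq _] /ffunP E.
  apply: (@eq_from_nth _ 0); rewrite ?sp ?sq // => i ltin.
  by have := E (Ordinal ltin); rewrite !ffunE.
move=> g; split=> [[g0 gn gS]|[p]].
  have gE i (lti : i < n.+1) : nth 0 [seq g i | i <- enum 'I_n.+1] i = g (Ordinal lti).
    by rewrite (nth_map ord0) ?size_enum_ord // (nth_ord_enum ord0 (Ordinal lti)).
  exists [seq g i | i <- enum 'I_n.+1].
    rewrite mem_motzkin_seqs size_map size_enum_ord eqxx /=.
    rewrite -nth0 -nth_last size_map size_enum_ord /= !gE; apply/and3P; split.
    - by apply/eqP; rewrite -[RHS]g0; congr (g _); apply: val_inj.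
    - by apply/eqP; rewrite -[RHS]gn; congr (g _); apply: val_inj.
    apply/(sortedP 0) => i; rewrite size_map size_enum_ord => lti.
    rewrite !gE ?(ltnW lti) // => lti'; rewrite -distn_le1; exact: gS.
  by apply/ffunP => i; rewrite ffunE gE; congr (g _); apply: val_inj.
rewrite mem_motzkin_seqs -nth0 -nth_last => /and4P[/eqP sp /eqP p0 /eqP pn /(sortedP 0) pS] ->.
rewrite sp in pn pS; split; rewrite ?ffunE //.
by move=> i j ij; rewrite !ffunE distn_le1 ij pS // -ij.
Qed.

End MotzkinPaths.

(** * Live starts, their marks, and the moves *)

(** The live starts in increasing order, each with its mark: [true] if it may
    not be closed before the next live start is. *)
Definition state := seq (nat * bool).
(** [Some x] closes an arc with start [x], and [None] is the absence of a cut. *)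
Definition letter := option nat.

Section Moves.
Implicit Types (u v st : state) (k x : nat).

Fixpoint unmark_last st : state :=
  match st with
  | [::] => [::]
  | [:: (x, _)] => [:: (x, false)]
  | s :: st' => s :: unmark_last st'
  end.

Definition mark_all st : state := [seq (s.1, true) | s <- st].

Fixpoint splits st : seq (state * nat * state) :=
  if st is (x, b) :: v then
    (if b then [::] else [:: ([::], x, v)]) ++
    [seq ((x, b) :: s.1.1, s.1.2, s.2) | s <- splits v]
  else [::].

(** The letters that may be put at column [k], with the state that follows.
    Closing an arc with start 0 or [x] marks all the starts above it, including
    the new start [k].  The start just below [x] loses its mark, since it only
    had to wait for [x].  Without a cut, the last live start need not wait any
    longer, as no arc starts at [k].  The start 0 is not listed in the state: it
    is never exhausted and never has to wait. *)
Definition moves k st : seq (letter * state) :=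
  (None, unmark_last st) ::
  (Some 0, rcons (mark_all st) (k, true)) ::
  [seq (Some s.1.2, unmark_last s.1.1 ++ rcons (mark_all s.2) (k, true))
     | s <- splits st].

Fixpoint ext l k st : seq (seq letter) :=
  if l is l'.+1 then [seq m.1 :: e | m <- moves k st, e <- ext l' k.+1 m.2]
  else [:: [::]].

Lemma splitsP u x v st : reflect (st = u ++ (x, false) :: v) ((u, x, v) \in splits st).
Proof.
apply: (iffP idP) => [|->].
  elim: st u => [|[y b] st IH] u //=; rewrite mem_cat => /orP[|].
    by case: b => //; rewrite inE => /eqP[-> -> ->].
  by case/mapP => -[[u' x'] v'] sI [-> xE vE]; rewrite xE vE (IH u') // xE vE.
elim: u => [|[y b] u IH]; first by rewrite /= inE eqxx.
rewrite cat_cons /= mem_cat; apply/orP; right.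
by apply/mapP; exists (u, x, v).
Qed.

End Moves.

(** * Counting by weights *)

Section Weight.
Import GRing.Theory.
Local Open Scope ring_scope.
Implicit Types (u v st : state).

(** The q-analogue of [a]. *)
Definition qnum (a : nat) : {poly int} := \sum_(i < a) 'X^i.

Lemma qnumD a b : qnum (a + b) = qnum a + 'X^a * qnum b.
Proof.
rewrite /qnum big_split_ord /= mulr_sumr; congr (_ + _).
by apply: eq_bigr => i _; rewrite exprD.
Qed.

Lemma qnum1 : qnum 1 = 1.
Proof. by rewrite /qnum big_ord1. Qed.

Lemma qnumSl a : qnum a.+1 = 1 + 'X * qnum a.
Proof. by rewrite -add1n qnumD qnum1 expr1. Qed.

Lemma qnumSr a : qnum a.+1 = qnum a + 'X^a.
Proof. by rewrite -addn1 qnumD qnum1 mulr1. Qed.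

(** The product of the [qnum (a_i + 2)] over the maximal runs of a_i marks
    between unmarked starts; the first argument is the length of the current
    run, which allows for an induction on the list. *)
Fixpoint weight a st : {poly int} :=
  match st with
  | [::] => qnum a.+2
  | (_, true) :: st' => weight a.+1 st'
  | (_, false) :: st' => qnum a.+2 * weight 0 st'
  end.

(** The weight of [unmark_last u] followed by [L] marked starts, preceded by a
    run of [a] marks ([weight_unmark_last]).  If [u] ends with a run of length
    b > 0, unmarking shortens it to b-1; if b = 0, the run is absent and
    [qnum 1 = 1] is the right factor again.  That is why there is no case
    distinction. *)
Fixpoint cut_weight a u L : {poly int} :=
  match u with
  | [::] => qnum a.+1 * qnum L.+2
  | (_, true) :: u' => cut_weight a.+1 u' L
  | (_, false) :: u' => qnum a.+2 * cut_weight 0 u' L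
  end.

Lemma weight_marked a st : all snd st -> weight a st = qnum (a + size st).+2.
Proof.
elim: st a => [|[x [] //] st IH] a /=; first by rewrite addn0.
by move=> /IH ->; rewrite addnS.
Qed.

Lemma weight_unmark_last a u v : all snd v -> (a == 0)%N || (u != [::]) ->
  weight a (unmark_last u ++ v) = cut_weight a u (size v).
Proof.
move=> vT; elim: u a => [|[x b] [|s u] IH] a.
- by rewrite orbF => /eqP -> /=; rewrite weight_marked // qnum1 mul1r.
- by case: b => _ /=; rewrite weight_marked // ?qnum1 ?mul1r.
- move=> _; have {}IH a' := IH a' (orbT _).
  case: b.
    exact: (IH a.+1).
  by transitivity (qnum a.+2 * cut_weight 0 (s :: u) (size v)); rewrite // -IH.
Qed.

Lemma all_mark_all st k : all snd (rcons (mark_all st) (k, true)).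
Proof. by rewrite all_rcons all_map /=; apply/allP. Qed.

Lemma size_mark_all st k : size (rcons (mark_all st) (k, true)) = (size st).+1.
Proof. by rewrite size_rcons size_map. Qed.

(** The three terms on the left stem from the absence of a cut, from closing an
    arc with start 0, and from closing one with a positive start.  When the list
    begins with an unmarked start, the statement for the rest is multiplied by
    [qnum a.+2]; this accounts for all the terms except those of closing 0 and
    closing this first unmarked start, and what remains is an identity between
    [qnum (a + b + 4)], [qnum (a + 1)], [qnum (a + 2)] and [qnum (b + 3)], where
    b is the size of the rest. *)
Lemma weight_balance a st :
  'X * (cut_weight a st 0 + qnum (a + size st).+3 +
    \sum_(s <- splits st) cut_weight a s.1.1 (size s.2).+1) + 1 =
  (1 + 'X + 'X^2) * weight a st.
Proof.
elim: st a => [|[x b] st IH] a /=.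
  rewrite big_nil addr0 addn0.
  rewrite !(qnumSl a.+2, qnumSl a.+1) (qnumSl 1) (qnumSr 0).
  rewrite [qnum 0]/qnum big_ord0; ring.
case: b => /=.
  by rewrite big_map /= -IH addnS addSn.
rewrite big_cons big_map /= -mulr_sumr.
have {}IH := IH 0%N; rewrite add0n in IH.
set S := \sum_(s <- _) _ in IH *; set C := cut_weight 0 st 0 in IH *.
set W := weight 0 st in IH *.
have -> : (1 + 'X + 'X^2) * (qnum a.+2 * W) = qnum a.+2 * ((1 + 'X + 'X^2) * W).
  by ring.
rewrite -IH [in LHS]addnS.
have -> : ((a + size st).+4 = a.+1 + (size st).+3)%N by lia.
rewrite qnumD (qnumSr a.+1).
have : 'X^(a.+1) = 1 + 'X * qnum a.+1 - qnum a.+1.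
  by rewrite -qnumSl qnumSr addrC addKr.
by move: ('X^(a.+1)) => Y ->; ring.
Qed.

(** Hence the moves act on weights as the steps of a Motzkin path act on
    heights. *)
Lemma mstep_weight k st :
  mstep (weight 0 st) = \sum_(m <- moves k st) weight 0 m.2.
Proof.
apply: mstep_eq; rewrite -weight_balance !big_cons big_map /=.
have -> : weight 0 (unmark_last st) = cut_weight 0 st 0.
  by rewrite -[unmark_last st]cats0 weight_unmark_last.
rewrite weight_marked ?all_mark_all // size_mark_all add0n addrA; congr (_ * (_ + _) + _).
by apply: eq_bigr => s _; rewrite weight_unmark_last ?all_mark_all // size_mark_all.
Qed.

Lemma size_ext l k st : Posz (size (ext l k st)) = mcount l (weight 0 st).
Proof.
elim: l k st => [|l IHl] k st.
  (* Every factor of a weight has constant term 1. *)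
  have w0 a u : (weight a u)`_0 = 1.
    elim: u a => [|[x []] u IH] a //=; rewrite ?coef0M ?IH ?mulr1;
    by rewrite qnumSl coefD coefXM coef1.
  by rewrite /mcount /= w0.
rewrite mcountS (mstep_weight k) mcount_sum.
rewrite -[ext _ _ _]/[seq m.1 :: e | m <- moves k st, e <- ext l k.+1 m.2].
rewrite size_allpairs_dep sumnE big_map (big_morph Posz PoszD (erefl _)).
by apply: eq_bigr => m _.
Qed.

(** The state without live starts has weight 1 + X, which is [mstep 1]. *)
Lemma size_ext_nil l k : size (ext l k [::]) = size (motzkin_seqs l.+1 0).
Proof.
apply/eqP; rewrite -eqz_nat size_ext size_motzkin_seqs mcountS expr0 mstep1.
by rewrite /= qnumSl qnum1 mulr1.
Qed.

End Weight.

(** * Admissible words and the states that represent them *)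

Section Words.
Implicit Types (w e : seq letter) (a : letter) (u v st : state) (k x p c y : nat).

(** In a word [w], the letter at column [k] is [nth None w k]; column 0 only
    carries a dummy [None].  The columns from [size w] on are yet to be read. *)
Definition live w p : bool := (nth None w p != None) && (Some p \notin w).

(** The arc that ends at [y] would be the first one of a linked triple with
    arcs starting at [p < c], if the arc from [p] ended before the one from
    [c]. *)
Definition blocks w p c y : bool :=
  if nth None w y is Some x then (x < p) && (c <= y.+1) else false.

Definition blocked w p c : bool := has (blocks w p c) (iota 0 (size w)).

(** The arc closed at the current column [size w] has to start at a live
    point, and must not be the middle arc of a linked triple.  The third arc
    starts at a live [c], or at the current column. *)
Definition admissible w a : Prop :=
  if a is Some x then
    (x == 0) || live w x /\
    forall c, x < c -> (c == size w) || live w c -> ~~ blocked w x c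
  else True.

Fixpoint admissible_from w e : Prop :=
  if e is a :: e' then admissible w a /\ admissible_from (rcons w a) e' else True.

Lemma blockedP w p c :
  reflect (exists y x, [/\ nth None w y = Some x, x < p & c <= y.+1]) (blocked w p c).
Proof.
rewrite /blocked /blocks; apply: (iffP hasP) => [[y _]|[y [x [wy xp cy]]]].
  by case wy: (nth None w y) => [x|] // /andP[xp cy]; exists y, x.
exists y; last by rewrite wy xp cy.
by rewrite mem_iota ltnNge; apply/negP => /(nth_default None); rewrite wy.
Qed.

Lemma blocked_mono w p p' c c' : p <= p' -> c' <= c -> blocked w p c -> blocked w p' c'.
Proof.
move=> pp' cc' /blockedP[y [x [wy xp cy]]]; apply/blockedP; exists y, x.
by split; [|exact: leq_trans pp'|exact: leq_trans cy].
Qed.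

Lemma blocked_rcons w a p c : blocked (rcons w a) p c =
  blocked w p c || (if a is Some x then (x < p) && (c <= (size w).+1) else false).
Proof.
rewrite /blocked size_rcons -addn1 iotaD has_cat /= orbF; congr (_ || _).
  by apply: eq_in_has => y; rewrite mem_iota add0n /blocks nth_rcons => /= ->.
by rewrite /blocks nth_rcons add0n ltnn eqxx addn1.
Qed.

Lemma blocked_size w p c : size w < c -> blocked w p c = false.
Proof.
move=> wc; apply/negP => /blockedP[y [x [wy _ cy]]].
have : size w <= y by rewrite -ltnS (leq_trans wc).
by move=> /(nth_default None); rewrite wy.
Qed.

(** Each mark says whether a start is blocked by the next one; [c] is what
    comes after the last one.  It suffices to look at the next start because
    [blocked w p c] is decreasing in [c]. *)
Fixpoint marks w c st : bool :=
  if st is (p, b) :: st' then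
    (b == blocked w p (head c (unzip1 st'))) && marks w c st'
  else true.

Lemma marks_cat w c u v :
  marks w c (u ++ v) = marks w (head c (unzip1 v)) u && marks w c v.
Proof.
elim: u => [|[p b] u IH] //=; rewrite IH andbA; congr (_ && _ && _).
by case: u {IH}.
Qed.

Lemma unzip1_unmark_last st : unzip1 (unmark_last st) = unzip1 st.
Proof. by elim: st => [|[p b] [|s st] IH] //=; congr cons; apply: IH. Qed.

Lemma unzip1_mark_all st k : unzip1 (rcons (mark_all st) (k, true)) = rcons (unzip1 st) k.
Proof. by rewrite /unzip1 map_rcons -map_comp. Qed.

(** What follows [st] is replaced by some [d] for which no element of [st] has to
    wait.  Only the last element looks beyond [st], so only its mark changes. *)
Lemma marks_unmark_last w c d st : all (fun p => ~~ blocked w p d) (unzip1 st) ->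
  marks w c st -> marks w d (unmark_last st).
Proof.
elim: st => [|[p b] [|[q b'] st] IH] //.
move=> /andP[_ bl] /andP[mp mst]; apply/andP; split; last exact: IH.
by move: mp; case: (st).
Qed.

Lemma marks_all w x c st : c <= (size w).+1 ->
  all (fun s => s.2 && (x < s.1 <= (size w).+1)) st -> marks (rcons w (Some x)) c st.
Proof.
move=> cw; elim: st => [|[p b] st IH] //= /andP[/and3P[-> xp _] ast].
rewrite IH // andbT blocked_rcons xp orbC; apply/eqP/esym; rewrite orbC.
case: st ast {IH} => [|[q b'] st] /=; rewrite ?cw ?orbT //.
by case/andP=> /and3P[_ _ ->]; rewrite orbT.
Qed.

Lemma eq_marks w w' c st :
  (forall p d, p \in unzip1 st -> blocked w p d = blocked w' p d) ->
  marks w c st = marks w' c st.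
Proof.
elim: st => [|[p b] st IH] //= E; rewrite E ?mem_head // IH // => q d qst.
by rewrite E // in_cons qst orbT.
Qed.

Record represents w st : Prop := Represents {
  rep_gt0 : 0 < size w;
  rep_sorted : path ltn 0 (unzip1 st);
  rep_live : forall p, (p \in unzip1 st) = live w p;
  rep_lt : forall x, Some x \in w -> x < size w;
  rep_marks : marks w (size w) st
}.

Lemma live_lt w p : live w p -> p < size w.
Proof.
by case/andP=> wp _; rewrite ltnNge; apply: contra wp => /(nth_default None) ->.
Qed.

Lemma represents0 : represents [:: None] [::].
Proof. by split=> // p; rewrite ?inE // /live; case: p => [|[|p]]. Qed.


Lemma live_rcons_None w p : live (rcons w None) p = live w p.
Proof.
rewrite /live nth_rcons mem_rcons inE orFb /=.
by case: ltngtP => // [lt|->]; rewrite (nth_default _ _) // ltnW.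
Qed.

Lemma represents_None w st : represents w st ->
  represents (rcons w None) (unmark_last st).
Proof.
case=> w0 st_sorted st_live wlt st_marks; split.
- by rewrite size_rcons.
- by rewrite unzip1_unmark_last.
- by move=> p; rewrite unzip1_unmark_last live_rcons_None.
- by move=> x; rewrite mem_rcons size_rcons inE => /wlt/ltnW.
have eq_blocked p d : blocked (rcons w None) p d = blocked w p d.
  by rewrite blocked_rcons orbF.
rewrite size_rcons (@eq_marks _ w) //.
apply: marks_unmark_last st_marks.
by apply/allP => p _; rewrite blocked_size.
Qed.

Lemma live_rcons_Some w x p : (forall y, Some y \in w -> y < size w) -> x < size w ->
  live (rcons w (Some x)) p = (p == size w) || (p != x) && live w p.
Proof.
move=> wlt xw; rewrite /live nth_rcons mem_rcons inE negb_or.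
rewrite -[Some p == Some x]/(p == x).
case: (ltngtP p (size w)) => [pw|pw|->] /=.
- by case: (nth _ _ _); rewrite ?andbF.
- by rewrite (nth_default _ (ltnW pw)) /= andbF.
rewrite gtn_eqF //=; apply/negP => /wlt; by rewrite ltnn.
Qed.

Lemma sorted_split x b u v : path ltn 0 (unzip1 (u ++ (x, b) :: v)) ->
  [/\ all (fun p => 0 < p < x) (unzip1 u), all (ltn x) (unzip1 v), 0 < x &
      path ltn 0 (unzip1 u ++ unzip1 v)].
Proof.
rewrite /unzip1 map_cat /= !(path_pairwise ltn_trans) /=.
rewrite !pairwise_cat !all_cat allrel_consr /=.
case/and5P=> /and3P[u0 x0 v0] /andP[ux uv] pu xv pv.
by split=> //; [rewrite all_predI u0 | rewrite u0 v0 uv pu].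
Qed.

Lemma path_ltn_rcons s k : 0 < k -> path ltn 0 s -> all (ltn^~ k) s ->
  path ltn 0 (rcons s k).
Proof.
rewrite !(path_pairwise ltn_trans) /= => k0 /andP[s0 ps] sk.
by rewrite all_rcons pairwise_rcons /= k0 s0 ps sk.
Qed.

Lemma represents_zero w st : represents w st ->
  represents (rcons w (Some 0)) (rcons (mark_all st) (size w, true)).
Proof.
case=> w0 st_sorted st_live wlt st_marks.
have st_lt p : p \in unzip1 st -> 0 < p < size w.
  move=> pst; rewrite live_lt -?st_live // andbT.
  by have /order_path_min/allP/(_ _ pst) := st_sorted; apply; apply: ltn_trans.
split.
- by rewrite size_rcons.
- rewrite unzip1_mark_all path_ltn_rcons //.
  by apply/allP => p /st_lt/andP[].
- move=> p; rewrite unzip1_mark_all mem_rcons inE live_rcons_Some // -st_live.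
  case: (boolP (p \in _)) => [/st_lt/andP[p0 _]|_]; last by rewrite andbF.
  by rewrite -lt0n p0.
- by move=> x; rewrite mem_rcons size_rcons inE => /predU1P[[->] //|/wlt/ltnW].
rewrite size_rcons; apply: marks_all => //.
rewrite all_rcons /= w0 leqnSn /= all_map; apply/allP => -[p b] pst /=.
have /st_lt/andP[-> ltp] : p \in unzip1 st by apply/mapP; exists (p, b).
by rewrite ltnW // ltnS ltnW.
Qed.

(** An element of [u] is below [x], so the new arc blocks nothing there; and as
    [x] was not blocked by its successor, nothing below [x] was blocked by it, so the last
    element of [u] becomes unmarked.  All that is above [x] gets blocked. *)
Lemma represents_split w u x v : represents w (u ++ (x, false) :: v) ->
  represents (rcons w (Some x)) (unmark_last u ++ rcons (mark_all v) (size w, true)).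
Proof.
case=> w0 st_sorted st_live wlt st_marks.
have [u_lt v_gt x_gt0 uv_sorted] := sorted_split st_sorted.
have st_lt p : p \in unzip1 (u ++ (x, false) :: v) -> p < size w.
  by rewrite st_live => /live_lt.
have xw : x < size w by rewrite st_lt // /unzip1 map_cat mem_cat mem_head orbT.
have unzipE : unzip1 (unmark_last u ++ rcons (mark_all v) (size w, true)) =
    rcons (unzip1 u ++ unzip1 v) (size w).
  by rewrite {1}/unzip1 map_cat -!/(unzip1 _) unzip1_unmark_last unzip1_mark_all rcons_cat.
have uv_lt : all (ltn^~ (size w)) (unzip1 u ++ unzip1 v).
  apply/allP => p puv; apply: st_lt; move: puv.
  by rewrite /unzip1 map_cat !mem_cat inE => /orP[->|->]; rewrite ?orbT.
split.
- by rewrite size_rcons.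
- by rewrite unzipE path_ltn_rcons.
- move=> p; rewrite unzipE mem_rcons inE live_rcons_Some // -st_live.
  congr (_ || _); rewrite /unzip1 map_cat !mem_cat inE /=.
  case: eqVneq => //= -> ; apply/norP; split; apply/negP => /mapP.
    move=> [s su xE]; move/allP/(_ s.1 (map_f _ su)): u_lt; by rewrite -xE ltnn andbF.
  move=> [s su xE]; move/allP/(_ s.1 (map_f _ su)): v_gt; by rewrite -xE /= ltnn.
- by move=> y; rewrite mem_rcons size_rcons inE => /predU1P[[->]|/wlt/ltnW //]; apply: ltnW.
move: st_marks; rewrite size_rcons !marks_cat => /andP[u_marks /= /andP[/eqP x_marks v_marks]].
have head_lt : head (size w) (unzip1 v) <= (size w).+1.
  move: uv_lt; rewrite all_cat => /andP[_]; case: (unzip1 v) => //= q s /andP[/ltnW/leqW].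
  by [].
have -> : head (size w).+1 (unzip1 (rcons (mark_all v) (size w, true))) =
    head (size w) (unzip1 v).
  by rewrite unzip1_mark_all; case: (unzip1 v).
apply/andP; split; last first.
  apply: marks_all => //.
  rewrite all_rcons /= xw leqnSn /= all_map; apply/allP => -[p b] pv /=.
  have pv' : p \in unzip1 v by apply/mapP; exists (p, b).
  have /= -> := allP v_gt _ pv'.
  have := allP uv_lt p; rewrite mem_cat pv' orbT => /(_ isT)/ltnW/leqW; exact.
rewrite (@eq_marks _ w).
  apply: marks_unmark_last u_marks.
  apply/allP => p /(allP u_lt)/andP[_ /ltnW px].
  by apply/negP => /(blocked_mono px (leqnn _)); rewrite -x_marks.
move=> p d; rewrite unzip1_unmark_last => /(allP u_lt)/andP[_ /ltnW px].
by rewrite blocked_rcons ltnNge px orbF.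
Qed.

(** The successor of a live start in a state, or else the current column, is
    the least candidate for the start of a third arc. *)
Lemma head_min p b u v k c : path ltn 0 (unzip1 (u ++ (p, b) :: v)) ->
  p < c -> c = k \/ c \in unzip1 (u ++ (p, b) :: v) ->
  (forall q, q \in unzip1 v -> q < k) ->
  head k (unzip1 v) <= c.
Proof.
move=> /[dup] /sorted_split[u_lt _ _ _]; rewrite /unzip1 map_cat /=.
rewrite (path_pairwise ltn_trans) /= pairwise_cat /= => /and5P[_ _ _ _ pv] pc ck vk.
case: ck => [->|].
  by case: (map _ _) vk => //= q s /(_ q (mem_head _ _))/ltnW.
rewrite mem_cat inE => /or3P[/(allP u_lt)/andP[_]|/eqP cp|].
- by rewrite ltnNge ltnW.
- by rewrite cp ltnn in pc.
case: (map _ _) pv => //= q s /andP[qs _]; rewrite inE => /predU1P[->//|/(allP qs)].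
exact: ltnW.
Qed.

Lemma admissible_split w u x v : represents w (u ++ (x, false) :: v) ->
  admissible w (Some x).
Proof.
case=> w0 st_sorted st_live wlt; rewrite marks_cat => /andP[_ /= /andP[/eqP x_marks _]].
split.
  by rewrite -st_live /unzip1 map_cat mem_cat mem_head !orbT.
move=> c xc ck; apply/negP => /(blocked_mono (leqnn x)) bl.
suff hc : head (size w) (unzip1 v) <= c by rewrite bl in x_marks.
apply: head_min st_sorted xc _ _.
  by case/orP: ck => [/eqP ->|]; [left | rewrite -st_live; right].
move=> q qv; apply: live_lt; rewrite -st_live /unzip1 map_cat mem_cat inE.
by move: qv; rewrite /unzip1 => ->; rewrite !orbT.
Qed.

(** A live start that is marked is blocked by its successor, hence only the
    unmarked ones can be closed. *)
Lemma admissible_SomeP w st x : represents w st -> admissible w (Some x) ->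
  x = 0 \/ exists u v, st = u ++ (x, false) :: v.
Proof.
case=> w0 st_sorted st_live wlt st_marks [/orP[/eqP|x_live] unblocked]; first by left.
have /mapP[[y b] /splitPr st_split /= xy] : x \in unzip1 st by rewrite st_live.
right; case: st_split st_sorted st_live st_marks => u v; rewrite -{y}xy.
move=> st_sorted st_live; rewrite marks_cat => /andP[_ /= /andP[/eqP bE _]].
suff -> : b = false by exists u, v.
rewrite bE; apply/negbTE/unblocked; have [_ v_gt _ _] := sorted_split st_sorted.
  by case: (unzip1 v) v_gt => /= [|q s /andP[]//]; rewrite live_lt.
move: (st_live (head (size w) (unzip1 v))) => <-; rewrite /unzip1 map_cat mem_cat map_cons inE.
by case: (map _ v) => [|q s] /=; rewrite ?inE ?eqxx ?orbT.
Qed.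

Lemma represents_moves w st a st' : represents w st ->
  (a, st') \in moves (size w) st -> represents (rcons w a) st' /\ admissible w a.
Proof.
move=> wst; rewrite !inE => /or3P[/eqP[-> ->]|/eqP[-> ->]|].
- by split=> //; apply: represents_None.
- split; first exact: represents_zero.
  by split=> // c _ _; apply/negP => /blockedP[y [x []]].
case/mapP => -[[u x] v] /splitsP st_split [-> ->] /=; rewrite st_split in wst.
by split; [exact: represents_split wst|exact: admissible_split wst].
Qed.

Lemma moves_admissible w st a : represents w st -> admissible w a ->
  exists st', (a, st') \in moves (size w) st.
Proof.
case: a => [x|] wst adm; last by eexists; apply: mem_head.
case: (admissible_SomeP wst adm) => [->|[u [v stE]]].
  by eexists; rewrite inE; apply/orP; right; apply: mem_head.
eexists; rewrite !inE; apply/or3P/Or33/mapP.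
by exists (u, x, v) => //; apply/splitsP.
Qed.

Lemma mem_ext w st l e : represents w st ->
  (e \in ext l (size w) st) <-> size e = l /\ admissible_from w e.
Proof.
elim: l w st e => [|l IHl] w st e wst.
  by case: e => [|a e] /=; rewrite inE; split=> // -[].
rewrite -[ext _ _ _]/[seq m.1 :: e | m <- moves (size w) st, e <- ext l (size w).+1 m.2].
split=> [/allpairsPdep[[a st'] [e' [mm em ->]]]|].
  have [wst' adm] := represents_moves wst mm.
  by move: em; rewrite -(size_rcons w a) => /(IHl _ _ _ wst')[/= -> ?].
case: e => [[]//|a e] [[se] [adm adm']].
have [st' mm] := moves_admissible wst adm.
have [wst' _] := represents_moves wst mm.
apply/allpairsPdep; exists (a, st'), e; split=> //.
by rewrite -(size_rcons w a); apply/IHl.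
Qed.

Lemma uniq_moves k st : path ltn 0 (unzip1 st) -> uniq (unzip1 (moves k st)).
Proof.
move=> st_sorted; rewrite /unzip1 /moves !map_cons -map_comp !cons_uniq inE negb_or.
have -> : [seq (fst \o (fun s => (Some s.1.2,
    unmark_last s.1.1 ++ rcons (mark_all s.2) (k, true)))) s | s <- splits st] =
   [seq Some s.1 | s <- st & ~~ s.2].
  elim: st {st_sorted} => [|[x b] st IH] //=.
  by case: b => /=; rewrite -IH -map_comp.
move: st_sorted; rewrite (path_pairwise ltn_trans) /= => /andP[/allP st_gt0 st_pw].
have us : uniq (unzip1 st) by apply: pairwise_uniq st_pw; apply: ltnn.
have -> (r : state) : [seq Some s.1 | s <- r] = map Some (map fst r) by rewrite -map_comp.
rewrite mem_map; last by move=> ? ? [].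
rewrite (map_inj_uniq (f := Some)); last by move=> ? ? [].
apply/and3P; split.
- by apply/negP => /mapP[].
- apply/negP => /mapP[[x b]]; rewrite mem_filter => /andP[_ xst] /= x0.
  have /st_gt0 : x \in unzip1 st by apply/mapP; exists (x, b).
  by rewrite -x0.
exact: subseq_uniq (map_subseq _ (filter_subseq _ _)) us.
Qed.

Lemma uniq_ext w st l : represents w st -> uniq (ext l (size w) st).
Proof.
elim: l w st => [|l IHl] w st wst //.
rewrite -[ext _ _ _]/[seq m.1 :: e | m <- moves (size w) st, e <- ext l (size w).+1 m.2].
have := uniq_moves (size w) (rep_sorted wst).
have : forall m, m \in moves (size w) st -> uniq (ext l (size w).+1 m.2).
  by move=> [a st'] /(represents_moves wst)[wst' _]; rewrite -(size_rcons w a) IHl.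
elim: (moves _ _) => [|m ms IHms] //= Ums /andP[m_ms ums].
rewrite cat_uniq map_inj_uniq => [|? ? [] //]; rewrite Ums ?mem_head //=.
rewrite IHms // ?andbT => [|m' m'ms]; last by rewrite Ums // inE m'ms orbT.
apply/hasP => -[e /allpairsPdep[m' [e' [m'ms _ ->]]]] /= /mapP[e'' _ [m'm _]].
by rewrite -m'm map_f in m_ms.
Qed.

End Words.

(** * Lists of arcs and their words *)

Section ArcLists.
Variable N : nat.
Implicit Types (L : seq (nat * nat)) (z : nat * nat) (w : seq letter) (x y k : nat).

Definition is_arc z : bool := z.1 < z.2 <= N.

Definition begins x L : nat := count (fun z => z.1 == x) L.
Definition ends y L : nat := count (fun z => z.2 == y) L.

Lemma count_ltS (f : nat * nat -> nat) k L :
  count (fun z => f z < k.+1) L = count (fun z => f z < k) L + count (fun z => f z == k) L.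
Proof. by elim: L => //= z L ->; case: (ltngtP (f z) k) => ?; lia. Qed.

Lemma count_covers k L : all is_arc L ->
  count (fun z => z.1 < k <= z.2) L + count (fun z => z.2 < k) L =
  count (fun z => z.1 < k) L.
Proof. by elim: L => //= z L IH /andP[/andP[zl _] /IH]; lia. Qed.

Lemma count_column k L : all is_arc L ->
  count (fun z => z.1 < k < z.2) L + count (fun z => z.2 < k.+1) L =
  count (fun z => z.1 < k) L.
Proof. by elim: L => //= z L IH /andP[/andP[zl _] /IH]; lia. Qed.

(** By [count_covers] and [count_column], the number of arcs over a point or a
    column is the number of starts before it minus the number of ends before
    it.  Comparing consecutive points and columns isolates the starts and the
    ends at [k]. *)
Lemma few_cuts_arcsP L : 0 < N -> all is_arc L ->
  (forall k, 0 < k <= N -> count (fun z => z.1 < k <= z.2) L = N.+1) /\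
  (forall k, 0 < k < N -> N <= count (fun z => z.1 < k < z.2) L <= N.+1) <->
  begins 0 L = N.+1 /\
  (forall k, 0 < k < N -> begins k L = ends k L /\ ends k L <= 1).
Proof.
move=> N0 La.
have lt0 (f : nat * nat -> nat) : count (fun z => f z < 0) L = 0 by exact: count_pred0.
have ends0 : ends 0 L = 0.
  rewrite /ends; elim: L La {lt0} => //= z L IH /andP[/andP[zl _] /IH ->]; lia.
split=> [[cov col]|[b0 bk]].
  split.
    have := cov 1; have := count_covers 1 La; rewrite !count_ltS !lt0 -/(ends 0 L) ends0.
    by rewrite -/(begins 0 L) N0 => + /(_ isT); lia.
  move=> k /andP[k0 kN].
  have := count_covers k La; have := count_covers k.+1 La; have := count_column k La.
  rewrite !(cov k) ?(cov k.+1) ?k0 //= ?(ltnW kN) //; have := col k; rewrite k0 kN => /(_ isT).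
  rewrite !count_ltS -!/(begins k L) -!/(ends k L); lia.
have cov k : 0 < k <= N -> count (fun z => z.1 < k) L = count (fun z => z.2 < k) L + N.+1.
  elim: k => [|[|k] IH] // /andP[_ kN].
    by rewrite !count_ltS !lt0 -/(ends 0 L) ends0 -/(begins 0 L) b0.
  have [] := bk k.+1 kN; have := IH (ltnW kN).
  by rewrite (count_ltS fst k.+1) (count_ltS snd k.+1) -/(begins k.+1 L) -/(ends k.+1 L); lia.
split=> k kN.
  by have := count_covers k La; have := cov k kN; lia.
have := count_column k La; rewrite (count_ltS snd) -/(ends k L).
by have [_] := bk k kN; have := cov k; lia.
Qed.

(** [w] is the word of [L].  Only the multiplicities of the arcs that end before
    [N] are prescribed; those of the arcs that end at [N] then follow from the
    numbers of starts ([codes_inj]). *)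
Record codes w L : Prop := Codes {
  code_size : size w = N;
  code0 : nth None w 0 = None;
  code_count : forall x y, y < N -> count_mem (x, y) L = (nth None w y == Some x);
  code_begins0 : begins 0 L = N.+1;
  code_begins : forall x, 0 < x < N -> begins x L = (nth None w x != None)
}.

Lemma codes_ends w L y : codes w L -> y < N -> ends y L = (nth None w y != None).
Proof.
move=> wL yN; have cE := code_count wL _ yN.
case wy: (nth None w y) => [x|] /=.
  transitivity (count_mem (x, y) L); last by rewrite cE wy eqxx.
  apply: eq_in_count => -[x' y'] /= zL; rewrite xpair_eqE.
  case: eqP => [y'y|]; last by rewrite andbF.
  move: zL; rewrite y'y -has_pred1 has_count cE wy andbT.
  by case: eqP => // -[->]; rewrite eqxx.
apply/eqP; rewrite -leqn0 leqNgt -has_count; apply/hasP => -[[x' y'] zL /= /eqP y'y].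
by move: zL; rewrite y'y -has_pred1 has_count cE wy.
Qed.

Lemma codes_mem w L x y : codes w L -> y < N ->
  ((x, y) \in L) = (nth None w y == Some x).
Proof. by move=> wL yN; rewrite -has_pred1 has_count (code_count wL) // lt0b. Qed.

Lemma codes_few_cuts w L : codes w L ->
  begins 0 L = N.+1 /\ (forall k, 0 < k < N -> begins k L = ends k L /\ ends k L <= 1).
Proof.
move=> wL; split=> [|k /[dup] kN /andP[_ kN']]; first exact: code_begins0 wL.
by rewrite (codes_ends wL) // (code_begins wL) //; case: (_ != _).
Qed.

Lemma begins_gt1 L x y y' : (x, y) \in L -> (x, y') \in L -> y != y' -> 1 < begins x L.
Proof.
move=> /perm_to_rem; set L' := rem _ _ => pL; rewrite (perm_mem pL) inE xpair_eqE eqxx /=.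
rewrite [begins _ _](permP pL) /= eqxx => + neq; rewrite eq_sym (negPf neq) ltnS -has_count.
by move=> zL'; apply/hasP; exists (x, y').
Qed.

Lemma codes_perm w L L' : perm_eq L L' -> codes w L -> codes w L'.
Proof.
move=> /permP p [s0 w0 wc b0 b].
split=> //; rewrite /begins -?p //.
- by move=> x y yN; rewrite -p wc.
- by move=> x xN; rewrite -p; apply: b.
Qed.

Lemma codes_inj w L L' : all is_arc L -> all is_arc L' ->
  codes w L -> codes w L' -> perm_eq L L'.
Proof.
move=> aL aL' wL wL'; apply/allP => -[x y] _ /=; apply/eqP.
case: (ltnP y N) => [yN|Ny]; first by rewrite (code_count wL) // (code_count wL').
case xyN: (is_arc (x, y)); last first.
  have c0 l : all is_arc l -> count_mem (x, y) l = 0.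
    by move=> al; apply/count_memPn/negP => /(allP al); rewrite xyN.
  by rewrite !c0.
have {xyN} [xN yN] : x < N /\ y = N by move: xyN; rewrite /is_arc /=; lia.
have splitE l : all is_arc l ->
    begins x l = count_mem (x, y) l + count (fun z => z.1 == x) [seq z <- l | z.2 < N].
  rewrite count_filter yN; elim: l => //= -[a b] l IH /andP[/andP[/= _ bN] /IH ->].
  by rewrite xpair_eqE; lia.
have : perm_eq [seq z <- L | z.2 < N] [seq z <- L' | z.2 < N].
  apply/allP => -[a b] _ /=; rewrite !count_filter; apply/eqP.
  have E l : count (predI (pred1 (a, b)) (fun z => z.2 < N)) l =
     if b < N then count_mem (a, b) l else 0.
    elim: l => [|[a' b'] l IH] /=; first by case: ifP.
    by rewrite IH xpair_eqE; case: (eqVneq a' a); case: (eqVneq b' b) => [->|]; case: ifP.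
  by rewrite !E; case: ifP => // bN; rewrite (code_count wL) // (code_count wL').
move=> /permP/(_ (fun z => z.1 == x)).
have := splitE _ aL; have := splitE _ aL'.
have -> : begins x L = begins x L'.
  case: (posnP x) => [->|x0]; first by rewrite (code_begins0 wL) (code_begins0 wL').
  by rewrite (code_begins wL) ?x0 // (code_begins wL') ?x0.
by move=> -> + E; rewrite E => /addIn ->.
Qed.

Lemma codes_uniq w w' L : codes w L -> codes w' L -> w = w'.
Proof.
move=> wL wL'; apply: (@eq_from_nth _ None).
  by rewrite (code_size wL) (code_size wL').
move=> y; rewrite (code_size wL) => yN.
have E x : (nth None w y == Some x) = (nth None w' y == Some x).
  by rewrite -(codes_mem x wL yN) -(codes_mem x wL' yN).
case wy: (nth None w y) E => [x|] E; first by have := E x; rewrite eqxx => /esym/eqP.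
by case wy': (nth None w' y) E => [x|] // /(_ x); rewrite eqxx.
Qed.

(** At most one arc ends at an inner column; its start is the letter there. *)
Lemma codes_exists L : all is_arc L -> begins 0 L = N.+1 ->
  (forall k, 0 < k < N -> begins k L = ends k L /\ ends k L <= 1) ->
  exists w, codes w L.
Proof.
move=> La b0 bk; pose starts y := [seq z.1 | z <- L & z.2 == y].
have size_starts y : size (starts y) = ends y L by rewrite size_map size_filter.
have starts0 : starts 0 = [::].
  rewrite /starts (_ : [seq z <- L | _] = [::]) //; apply/eqP; rewrite -size_eq0 size_filter.
  rewrite -leqn0 leqNgt -has_count; apply/hasP => -[z /(allP La)/andP[zl _] /eqP z2].
  by rewrite z2 in zl.
have startsE y : y < N -> ends y L = (ohead (starts y) != None) /\
    forall x, count_mem x (starts y) = (ohead (starts y) == Some x).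
  move=> yN; have : size (starts y) <= 1.
    case: (posnP y) => [->|y0]; rewrite ?starts0 // size_starts.
    by apply: (bk y _).2; rewrite y0.
  rewrite -size_starts; case: (starts y) => [|x [|//]] _; split=> // x' /=.
  by rewrite addn0; congr nat_of_bool.
exists (mkseq (fun y => ohead (starts y)) N); split=> //.
- by rewrite size_mkseq.
- by case: (posnP N) => [->//|N0]; rewrite nth_mkseq // starts0.
- move=> x y yN; rewrite nth_mkseq // -(startsE y yN).2 count_map count_filter.
  by apply: eq_count => -[a b]; rewrite /= xpair_eqE.
move=> x /[dup] xN /andP[_ xN']; rewrite nth_mkseq // -(startsE x xN').1.
exact: (bk x xN).1.
Qed.

(** There is no linked triple, in terms of arcs. *)
Definition no_chain L : Prop := forall zA zB zC, zA \in L -> zB \in L -> zC \in L ->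
  zA.1 < zB.1 < zC.1 -> zC.1 <= zA.2.+1 -> zA.2 < zB.2 < zC.2 -> False.

Definition admissible_word w : Prop :=
  forall k, 0 < k < N -> admissible (take k w) (nth None w k).

Lemma live_takeP w k p : k < size w ->
  reflect [/\ p < k, nth None w p != None & forall y, y < k -> nth None w y != Some p]
    (live (take k w) p).
Proof.
move=> kw; have sk : size (take k w) = k by rewrite size_take kw.
apply: (iffP idP) => [lp|[pk wp wy]].
  have pk : p < k by rewrite -[X in _ < X]sk live_lt.
  move: lp; rewrite /live nth_take // => /andP[wp /negP wpN]; split=> // y yk.
  by apply/negP => /eqP wy; apply: wpN; rewrite -wy -(nth_take _ yk) mem_nth ?sk.
rewrite /live nth_take // wp; apply/negP => /(nthP None)[y]; rewrite sk => yk.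
by rewrite nth_take // => /eqP; rewrite (negPf (wy y yk)).
Qed.

(** In a linked triple, look at the word at the end [k] of the middle arc: the
    first arc has ended before, and the start of the third one is live or equal
    to [k], because every positive start belongs to a single arc.  Conversely, a
    live start, or a start at [k], is the start of an arc that ends after
    [k]. *)
Lemma no_chainP w L : all is_arc L -> codes w L -> no_chain L <-> admissible_word w.
Proof.
move=> La wL; have arcL z : z \in L -> z.1 < z.2 <= N by move/(allP La).
have b_le1 x : 0 < x < N -> begins x L <= 1.
  by move=> xN; rewrite (code_begins wL) //; case: (_ != _).
have cutL x y : 0 < x -> (x, y) \in L -> x < N -> nth None w x != None.
  move=> x0 xy xN; have : 0 < begins x L.
    by rewrite -has_count; apply/hasP; exists (x, y) => /=.
  by rewrite (code_begins wL) ?x0 // lt0b.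
split=> [Lno k /[dup] kN /andP[k0 ltkN]|wadm [xA yA] [xB yB] [xC yC] /= LA LB LC].
  have kw : k < size w by rewrite (code_size wL).
  case wk: (nth None w k) => [x|] //=.
  have xkL : (x, k) \in L by rewrite (codes_mem _ wL) // wk.
  have /andP[/= xk _] := arcL _ xkL.
  have xN := ltn_trans xk ltkN.
  split.
    case: posnP => //= x0; apply/(live_takeP _ kw); split=> //; first exact: cutL xkL _.
    move=> y yk; rewrite -(codes_mem _ wL) ?(ltn_trans yk) //; apply/negP => xyL.
    have := b_le1 x; rewrite x0 xN => /(_ isT); rewrite leqNgt.
    by rewrite (begins_gt1 xyL xkL) // ltn_eqF.
  move=> c xc; rewrite size_take kw => ck; apply/negP => /blockedP[y [a [wy ax cy]]].
  have yk : y < k.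
    rewrite ltnNge; apply/negP => ky.
    by rewrite nth_default // size_take kw in wy.
  rewrite nth_take // in wy.
  have ayL : (a, y) \in L by rewrite (codes_mem _ wL) ?wy // (ltn_trans yk).
  have cN : c <= k by apply: leq_trans cy _.
  have c_cut : nth None w c != None.
    by case/orP: ck => [/eqP ->|/(live_takeP _ kw)[]]; rewrite ?wk.
  have : 0 < begins c L.
    by rewrite (code_begins wL) ?c_cut // (leq_ltn_trans cN) // andbT (leq_ltn_trans _ xc).
  rewrite -has_count => /hasP[[c' yC] cL /eqP /= cE]; rewrite {c'}cE in cL.
  apply: (Lno _ _ _ ayL xkL cL); rewrite /= ?ax ?yk //= ltnNge; apply/negP.
  rewrite leq_eqVlt => /orP[/eqP yCk|yCk].
    by move: cL; rewrite yCk (codes_mem _ wL) // wk => /eqP[xE]; rewrite xE ltnn in xc.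
  case/orP: ck => [/eqP ck|/(live_takeP _ kw)[_ _ /(_ _ yCk)]].
    by have /andP[/= + _] := arcL _ cL; rewrite ck ltnNge (ltnW yCk).
  by rewrite -(codes_mem _ wL) ?cL // (ltn_trans yCk).
move=> /andP[xAB xBC] xCA /andP[yAB yBC].
have /andP[/= _ yCN] := arcL _ LC.
have yBN : yB < N := leq_trans yBC yCN.
have yAN := ltn_trans yAB yBN.
have yBw : yB < size w by rewrite (code_size wL).
have wB : nth None w yB = Some xB by apply/eqP; rewrite -(codes_mem _ wL).
have wA : nth None w yA = Some xA by apply/eqP; rewrite -(codes_mem _ wL).
have xCyB : xC <= yB by apply: leq_trans yAB.
have xCN := leq_ltn_trans xCyB yBN.
have := wadm yB; rewrite yBN (leq_trans _ yAB) // wB => /(_ isT)[_ /(_ _ xBC)].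
rewrite size_take yBw => unblocked.
have /negP[] : ~~ blocked (take yB w) xB xC.
  apply: unblocked; rewrite orbC -implyNb; apply/implyP => nlive.
  rewrite eqn_leq xCyB leqNgt; apply: contra nlive => ltCB; apply/live_takeP => //.
  have xC0 : 0 < xC by apply: leq_ltn_trans xBC.
  split=> //; first exact: cutL LC _.
  move=> y yyB; have yN := ltn_trans yyB yBN.
  rewrite -(codes_mem _ wL) //; apply/negP => LC'.
  have := b_le1 xC; rewrite xC0 xCN => /(_ isT); rewrite leqNgt.
  by rewrite (begins_gt1 LC' LC) // ltn_eqF // (ltn_trans yyB).
by apply/blockedP; exists yA, xA; rewrite nth_take.
Qed.

End ArcLists.

(** * The arcs of an admissible word *)

Section WordArcs.
Variable N : nat.
Hypothesis N_gt0 : 0 < N.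
Implicit Types (L : seq (nat * nat)) (w : seq letter) (x y k : nat).

Definition closed_arcs w : seq (nat * nat) :=
  [seq (odflt 0 (nth None w y), y) | y <- iota 0 N & nth None w y].

(** The number of arcs with start [x] that are still open at the end. *)
Definition remaining w x : nat :=
  (if x == 0 then N.+1 else nat_of_bool (nth None w x != None)) - count_mem (Some x) w.

Definition open_arcs w : seq (nat * nat) :=
  flatten [seq nseq (remaining w x) (x, N) | x <- iota 0 N].

Definition arcs_of w : seq (nat * nat) := closed_arcs w ++ open_arcs w.

Lemma count_open (p : pred (nat * nat)) w :
  count p (open_arcs w) = \sum_(x < N) p (val x, N) * remaining w x.
Proof.
rewrite /open_arcs count_flatten -map_comp sumnE big_map.
rewrite -[X in iota 0 X]subn0 -/(index_iota 0 N) big_mkord.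
by apply: eq_bigr => x _; rewrite /= count_nseq.
Qed.

Lemma admissible_word_arcs w : size w = N -> nth None w 0 = None -> admissible_word N w ->
  (forall x y, nth None w y = Some x -> x < y) /\
  (forall x, 0 < x < N -> count_mem (Some x) w <= (nth None w x != None)).
Proof.
move=> sw w0 wadm.
have w_lt y x : nth None w y = Some x -> 0 < y < N.
  case: y => [|y] wy; first by rewrite w0 in wy.
  by rewrite /= -sw ltnNge; apply/negP => /(nth_default None); rewrite wy.
have w_live y x : 0 < x -> nth None w y = Some x ->
    [/\ x < y, nth None w x != None & forall y', y' < y -> nth None w y' != Some x].
  move=> x0 wy; have yN := w_lt _ _ wy.
  have := wadm y yN; rewrite wy => -[+ _]; rewrite gtn_eqF //= => lx.
  by apply/live_takeP => //; rewrite sw; case/andP: yN.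
split=> [x y wy|x /andP[x0 xN]].
  by case: (posnP x) => [->|x0]; [case/andP: (w_lt _ _ wy) | case: (w_live _ _ x0 wy)].
case: (boolP (Some x \in w)) => [|/count_memPn -> //].
move=> /(nthP None)[y yw wy]; have [_ -> wy'] := w_live _ _ x0 wy.
rewrite -(mkseq_nth None w) count_map (@eq_count _ _ (pred1 y)).
  by rewrite count_uniq_mem ?iota_uniq //; case: (_ \in _).
move=> y'' /=; apply/eqP/eqP => [wy''|-> //].
case: (ltngtP y'' y) => // [/wy'|lt]; first by rewrite wy'' eqxx.
by have [_ _ /(_ _ lt)] := w_live _ _ x0 wy''; rewrite wy eqxx.
Qed.

Lemma arcs_ofP w : size w = N -> nth None w 0 = None -> admissible_word N w ->
  all (is_arc N) (arcs_of w) /\ codes N w (arcs_of w).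
Proof.
move=> sw w0 wadm; have [w_lt w_count] := admissible_word_arcs sw w0 wadm.
have w_lt' y x : nth None w y = Some x -> y < N.
  by move=> wy; rewrite -sw ltnNge; apply/negP => /(nth_default None); rewrite wy.
split.
  rewrite all_cat; apply/andP; split; apply/allP => z.
    case/mapP => y; rewrite mem_filter mem_iota add0n => /andP[] /=.
    by case wy: (nth None w y) => [x|] // _ /ltnW yN ->; rewrite /is_arc /= (w_lt _ _ wy).
  case/flattenP => s /mapP[x]; rewrite mem_iota add0n /= => xN -> /nseqP[-> _].
  by rewrite /is_arc /= xN /=.
have begin_closed x : begins x (closed_arcs w) = count_mem (Some x) w.
  rewrite /begins count_map count_filter -[in RHS](mkseq_nth None w) count_map sw.
  by apply: eq_count => y /=; case: (nth None w y) => [x'|] /=; rewrite ?andbT ?andbF.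
have begin_open x : x < N -> begins x (open_arcs w) = remaining w x.
  move=> xN; rewrite /begins count_open (bigD1 (Ordinal xN)) //= eqxx mul1n.
  by rewrite big1 ?addn0 // => i /negPf ix; rewrite -[_ == x]/(i == Ordinal xN) ix.
have beginE x : x < N -> begins x (arcs_of w) =
  maxn (count_mem (Some x) w) (if x == 0 then N.+1 else nat_of_bool (nth None w x != None)).
  by move=> xN; rewrite /begins count_cat -!/(begins _ _) begin_closed begin_open // maxnE.
split=> //.
- move=> x y yN; rewrite count_cat count_open big1 ?addn0 => [|i _]; last first.
    by rewrite /= xpair_eqE (gtn_eqF yN) andbF.
  rewrite count_uniq_mem; last first.
    rewrite map_inj_in_uniq ?filter_uniq ?iota_uniq // => a b _ _ []; exact.
  congr nat_of_bool; apply/mapP/eqP => [[y' + [-> ->]]|wy].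
    by rewrite mem_filter; case: (nth None w y').
  by exists y; rewrite ?mem_filter ?wy // mem_iota.
- rewrite beginE //=; apply/maxn_idPr; rewrite -sw; apply: leqW.
  exact: count_size.
move=> x /[dup] xN /andP[x0 xN']; rewrite beginE // (gtn_eqF x0).
by apply/maxn_idPr/w_count.
Qed.

End WordArcs.

(** * The list of admissible words *)

Lemma admissible_fromP w e : admissible_from w e <->
  forall i, i < size e -> admissible (w ++ take i e) (nth None e i).
Proof.
elim: e w => [|a e IH] w; first by split.
split=> [[adm /IH adms] [_|i ie]|adm] /=; first by rewrite cats0.
  by rewrite -cat_rcons; apply: adms.
split; first by have := adm 0 isT; rewrite /= cats0.
by apply/IH => i ie; have := adm i.+1 ie; rewrite /= -cat_rcons.
Qed.

Definition words m : seq (seq letter) := [seq None :: e | e <- ext m 1 [::]].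

Lemma size_words m : size (words m) = motzkin m.+1.
Proof. by rewrite size_map size_ext_nil motzkinE. Qed.

Lemma uniq_words m : uniq (words m).
Proof. by rewrite map_inj_uniq => [|? ? [] //]; exact: uniq_ext m represents0. Qed.

Lemma mem_words m w : w \in words m <->
  [/\ size w = m.+1, nth None w 0 = None & admissible_word m.+1 w].
Proof.
have extP e : e \in ext m 1 [::] <-> size e = m /\ admissible_word m.+1 (None :: e).
  split=> [/(mem_ext m e represents0)[se /admissible_fromP adm]|[se adm]].
    by split=> // -[//|k] /andP[_ km]; apply: adm; rewrite se.
  apply/(mem_ext m e represents0); split=> //; apply/admissible_fromP => i ie.
  by apply: (adm i.+1); rewrite -se.
split=> [/mapP[e /extP[se adm] ->]|]; first by split; rewrite //= se.
case: w => [|a e] [] //= [se] a0 adm; rewrite a0; apply/mapP; exists e => //.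
by apply/extP; rewrite -a0.
Qed.

(** * Multisegments as lists of arcs *)

Section Multisegments.
Variable m : nat.
Let N := m.+1.
Implicit Types (A B C : segment N) (M : {mset segment N}%mset).

Definition arc A : nat * nat := ((sbegin A).-1, send A).

Definition arcs M : seq (nat * nat) := [seq arc A | A <- M].

Definition full_segment : segment N := exist _ (1, N) (leqnn N).

Definition seg (z : nat * nat) : segment N := insubd full_segment (z.1.+1, z.2).

Lemma arcP A : is_arc N (arc A).
Proof. by case: A => -[[|x] y]. Qed.

Lemma sbeginE A : sbegin A = (arc A).1.+1.
Proof. by case: A => -[[|x] y]. Qed.

Lemma segK z : is_arc N z -> arc (seg z) = z.
Proof. by case: z => x y xy; rewrite /arc /sbegin /send val_insubd ifT. Qed.

Lemma arc_inj : injective arc.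
Proof.
move=> A B [E1 E2]; apply: val_inj; rewrite [LHS]surjective_pairing [RHS]surjective_pairing.
by congr pair => //; have := sbeginE A; rewrite /= E1 -(sbeginE B).
Qed.

Lemma all_arcs M : all (is_arc N) (arcs M).
Proof. by apply/allP => _ /mapP[A _ ->]; apply: arcP. Qed.

Lemma few_cutsP M : few_cuts N M <-> begins 0 (arcs M) = N.+1 /\
  (forall k, 0 < k < N -> begins k (arcs M) = ends k (arcs M) /\ ends k (arcs M) <= 1).
Proof.
rewrite -few_cuts_arcsP ?all_arcs //.
have covE k : count (fun z => z.1 < k <= z.2) (arcs M) = count (covers k) M.
  by rewrite count_map; apply: eq_count => A; rewrite /= /covers sbeginE.
have colE k : count (fun z => z.1 < k < z.2) (arcs M) = count (contains_column k) M.
  by rewrite count_map; apply: eq_count => A; rewrite /= /contains_column sbeginE.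
split=> [[reg cuts]|[reg cuts]]; split=> k kN; rewrite ?covE ?reg //.
  by have [c c1] := cuts k kN; rewrite /has_cuts colE; lia.
  by have := reg k kN; rewrite covE.
exists (N.+1 - count (contains_column k) M); rewrite /has_cuts -colE; have := cuts k kN; lia.
Qed.

Lemma coversE k A : covers k A = ((arc A).1 < k <= (arc A).2).
Proof. by rewrite /covers sbeginE. Qed.

Lemma linkedP A B : linked A B <->
  [/\ (arc A).1 < (arc B).1, (arc A).2 < (arc B).2 & (arc B).1 <= (arc A).2].
Proof.
have := arcP A; have := arcP B; rewrite /linked /is_arc !sbeginE ltnS.
rewrite -![send _]/(arc _).2; move=> Ba Aa.
split=> [[xAB yAB [C CE]]|[xAB yAB xBA]]; split=> //.
  rewrite leqNgt; apply/negP => yAxB.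
  (* The union contains the ends of both segments, hence also the point just
     after the end of [A], which neither of them contains. *)
  have := (CE (arc A).2, CE (arc A).2.+1, CE (arc B).2).
  rewrite !coversE; case=> -[]; lia.
exists (seg ((arc A).1, (arc B).2)) => k; rewrite !coversE segK /is_arc;
  by move: Aa Ba xAB yAB xBA; case: (arc A) => xA yA; case: (arc B) => xB yB /=; lia.
Qed.

(** Three linked pairs would require x_B <= y_A, x_C <= y_B and x_C <= y_A.
    Quasi-linkedness weakens the last inequality to x_C <= y_A + 1, which still
    implies the other two, since x_B < x_C and y_A < y_B. *)
Lemma linked_tripleP A B C : linked_triple A B C <->
  [/\ (arc A).1 < (arc B).1 < (arc C).1, (arc C).1 <= (arc A).2.+1 &
      (arc A).2 < (arc B).2 < (arc C).2].
Proof.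
have := arcP A; have := arcP B; have := arcP C.
rewrite /is_arc => Ca Ba Aa; rewrite /linked_triple /quasi_linked.
rewrite -[send A]/(arc A).2 sbeginE; split.
  by case=> /linkedP[? ? ?] /linkedP[? ? ?] [/linkedP[? ? ?]|?]; split; lia.
case=> xs xCA ys; split; [by apply/linkedP; split; lia|by apply/linkedP; split; lia|].
case: (leqP (arc C).1 (arc A).2) => [le|gt]; last by right; lia.
by left; apply/linkedP; split=> //; lia.
Qed.

Lemma excessiveP M : excessive N M <-> few_cuts N M /\ no_chain (arcs M).
Proof.
split=> [[fc no3]|[fc nochain]]; split=> //.
  move=> _ _ _ /mapP[A AM ->] /mapP[B BM ->] /mapP[C CM ->] xs xCA ys.
  by apply: no3; exists A, B, C; split=> //; apply/linked_tripleP.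
move=> [A [B [C [AM BM CM /linked_tripleP[]]]]].
by apply: nochain; apply: map_f.
Qed.

Definition mset_of_word (w : seq letter) : {mset segment N}%mset :=
  seq_mset [seq seg z | z <- arcs_of N w].

Lemma arcs_mset_of w : w \in words m -> perm_eq (arcs (mset_of_word w)) (arcs_of N w).
Proof.
move=> /mem_words[sw w0 adm]; have [aw _] := arcs_ofP (ltn0Sn m) sw w0 adm.
rewrite (perm_trans (perm_map _ (perm_eq_seq_mset _))) // -map_comp.
rewrite map_id_in // => z /(allP aw); exact: segK.
Qed.

Lemma arcs_inj M M' : perm_eq (arcs M) (arcs M') -> M = M'.
Proof.
move=> /permP p; apply/msetP => A; rewrite -!count_mem_mset.
have := p (pred1 (arc A)); rewrite !count_map.
by congr (_ = _); apply: eq_count => B /=; rewrite (inj_eq arc_inj).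
Qed.

End Multisegments.

Lemma card_excessiveS m : (excessive m.+1 #= `I_(motzkin m.+1))%card.
Proof.
rewrite -size_words.
have wordsP w : w \in words m -> codes m.+1 w (arcs (mset_of_word m w)).
  move=> /[dup] wm /mem_words[sw w0 adm]; have [_] := arcs_ofP (ltn0Sn m) sw w0 adm.
  by apply: codes_perm; rewrite perm_sym arcs_mset_of.
apply: (card_eq_image_seq (f := @mset_of_word m)); first exact: uniq_words.
  move=> w w' /wordsP c /wordsP c' E; rewrite E in c; exact: codes_uniq c c'.
move=> M; split=> [/excessiveP[/few_cutsP[b0 bk] nochain]|[w wm ->]].
  have [w wM] := codes_exists (all_arcs M) b0 bk.
  have wm : w \in words m.
    apply/mem_words; split; [exact: code_size wM|exact: code0 wM|].
    by apply/(no_chainP (all_arcs _) wM).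
  exists w => //; apply: arcs_inj; apply: codes_inj wM (wordsP _ wm); exact: all_arcs.
have [_ _ adm] := (mem_words m w).1 wm.
apply/excessiveP; split; first by apply/few_cutsP/codes_few_cuts/wordsP.
by apply/(no_chainP (all_arcs _) (wordsP _ wm)).
Qed.

Theorem corollary5p6 (n : nat) :
  (excessive n #= `I_(motzkin n))%card.
Proof.
case: n => [|m]; last exact: card_excessiveS.
rewrite excessive0 few_cuts0 motzkinE; exact: card_set1.
Qed.
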